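(* Let $C_2$ be a projective primitive double curve with associated smooth reduced curve $C$, and suppose that $C_2$ is embedded in a smooth surface $S$ (so that $C_2\subset S$ is the double of the curve $C\subset S$, with ideal sheaf $\mathcal{O}_S(-2C)$). Let $E$ be a vector bundle on $C$. Then the canonical morphism $$\mathrm{Ext}^1_{\mathcal{O}_{C_2}}(E,E)\longrightarrow\mathrm{Ext}^1_{\mathcal{O}_S}(E,E)$$ is an isomorphism.
   Context: Everything is over $\mathbb{C}$. $C$ is a smooth irreducible projective curve. $E$ is viewed as a coherent sheaf on $C_2$ and on $S$ by pushforward along the inclusions $C\subset C_2\subset S$. The canonical morphism sends the class of an extension of $\mathcal{O}_{C_2}$-modules to its class as an extension of $\mathcal{O}_S$-modules. *)

(* Defs.v *)
From HB Require Import structures.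
From mathcomp Require Import all_boot all_order all_algebra.
From mathcomp Require Import complex.
From mathcomp Require Import all_classical all_reals topology.

Set Implicit Arguments.
Unset Strict Implicit.
Unset Printing Implicit Defensive.

Import GRing.Theory.
Local Open Scope classical_set_scope.
Local Open Scope ring_scope.

(* Rings of sections are [comPzRingType]s, which may be trivial: the ring of
   sections over the empty set is 0. *)

Section CommutativeAlgebra.
Variable A : comPzRingType.

Definition invertible (a : A) := exists b, a * b = 1.

Definition nonunits : set A := [set a | ~ invertible a].

Definition is_ideal (I : set A) :=
  [/\ I 0, forall a b, I a -> I b -> I (a + b) & forall a b, I b -> I (a * b)].

Definition is_prime (p : set A) :=
  [/\ is_ideal p, ~ p 1 & forall a b, p (a * b) -> p a \/ p b].

Definition ideal_gen n (x : 'I_n -> A) : set A :=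
  [set a | exists c : 'I_n -> A, a = \sum_k c k * x k].

Definition is_noetherian :=
  forall I : set A, is_ideal I -> exists n (x : 'I_n -> A), I = ideal_gen x.

(* The zero ring is excluded, since 0 must be a nonunit. *)
Definition is_local := is_ideal nonunits.

Definition prime_chain n (p : nat -> set A) :=
  (forall k, (k <= n)%N -> is_prime (p k)) /\
  (forall k, (k < n)%N -> p k `<` p k.+1).

Definition has_krull_dim d :=
  (exists p, prime_chain d p) /\
  (forall n p, prime_chain n p -> (n <= d)%N).

Definition is_regular_local d :=
  [/\ is_noetherian, is_local, has_krull_dim d
    & exists x : 'I_d -> A, nonunits = ideal_gen x].

(* The maximal ideal contains a regular sequence of length the dimension. *)
Definition is_cohen_macaulay_local :=
  [/\ is_noetherian, is_local
    & exists d (x : nat -> A), has_krull_dim d /\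
      forall k, (k < d)%N ->
        nonunits (x k) /\
        forall y, ideal_gen (fun l : 'I_k => x l) (x k * y) ->
                  ideal_gen (fun l : 'I_k => x l) y].

End CommutativeAlgebra.

Definition is_localization_at (A B : comPzRingType) (f : A)
    (h : {rmorphism A -> B}) :=
  [/\ invertible (h f),
      forall b, exists n a, b * h f ^+ n = h a
    & forall a, h a = 0 -> exists n, f ^+ n * a = 0].

Definition is_finitely_generated (K A : comPzRingType)
    (k : {rmorphism K -> A}) :=
  exists n (x : 'I_n -> A), forall B : set A,
    (forall c, B (k c)) -> (forall l, B (x l)) ->
    (forall a b, B a -> B b -> B (a + b)) ->
    (forall a b, B a -> B b -> B (a * b)) -> B = setT.

(* A is the polynomial algebra K[x_0, ..., x_(n-1)]. *)
Definition is_polynomial_algebra (K A : comPzRingType)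
    (k : {rmorphism K -> A}) n (x : 'I_n -> A) :=
  forall (B : comPzRingType) (kB : {rmorphism K -> B}) (b : 'I_n -> B),
    exists f : {rmorphism A -> B},
      [/\ forall c, f (k c) = kB c, forall l, f (x l) = b l
        & forall g : {rmorphism A -> B},
            (forall c, g (k c) = kB c) -> (forall l, g (x l) = b l) ->
            g =1 f].

Definition restr (A B : pzRingType) (f : {rmorphism A -> B}) (M : lmodType B)
  : Type := M.

Section RestrictionOfScalars.
Variables (A B : pzRingType) (f : {rmorphism A -> B}) (M : lmodType B).

HB.instance Definition _ := GRing.Zmodule.on (restr f M).

Definition restr_scale (a : A) (m : restr f M) : restr f M := f a *: (m : M).

Fact restr_scalerA a b m :
  restr_scale a (restr_scale b m) = restr_scale (a * b) m.
Proof. by rewrite /restr_scale rmorphM scalerA. Qed.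

Fact restr_scale1r : left_id 1 restr_scale.
Proof. by move=> m; rewrite /restr_scale rmorph1 scale1r. Qed.

Fact restr_scalerDr : right_distributive restr_scale +%R.
Proof. by move=> a m n; rewrite /restr_scale scalerDr. Qed.

Fact restr_scalerDl m : {morph restr_scale^~ m : a b / a + b}.
Proof. by move=> a b; rewrite /restr_scale rmorphD scalerDl. Qed.

HB.instance Definition _ := GRing.Zmodule_isLmodule.Build A (restr f M)
  restr_scalerA restr_scale1r restr_scalerDr restr_scalerDl.

End RestrictionOfScalars.

Record opens (X : topologicalType) := Opens {
  oset :> set X;
  oset_open : open oset
}.

Definition sub_refl (T : Type) (A : set T) : A `<=` A := fun _ => id.

Record continuous_map (X Y : topologicalType) := ContinuousMap {
  cfun :> X -> Y;
  cfun_open : forall V : set Y, open V -> open (cfun @^-1` V)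
}.

Definition preim (X Y : topologicalType) (f : continuous_map X Y)
    (V : opens Y) : opens X :=
  Opens (cfun_open f (oset_open V)).

Lemma preim_sub (X Y : topologicalType) (f : continuous_map X Y)
  (V W : opens Y) : W `<=` V -> preim f W `<=` preim f V.
Proof. by move=> WV x /WV. Qed.

Definition idmap (X : topologicalType) : continuous_map X X :=
  @ContinuousMap X X id (fun V oV => oV).

Definition compmap (X Y Z : topologicalType) (g : continuous_map Y Z)
    (f : continuous_map X Y) : continuous_map X Z :=
  @ContinuousMap X Z (fun x => g (f x))
    (fun V oV => cfun_open f (cfun_open g oV)).

(* [res s] is the restriction of s; compatibility of a family is tested on all
   opens W contained in two members rather than on their intersection. *)
Definition sheaf_axiom (X : topologicalType) (F : opens X -> Type)
    (res : forall U V : opens X, V `<=` U -> F U -> F V) :=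
  forall (U : opens X) (I : Type) (V : I -> opens X)
         (VU : forall k, V k `<=` U),
    (U : set X) `<=` \bigcup_k V k ->
    (forall s t : F U,
       (forall k, res U (V k) (VU k) s = res U (V k) (VU k) t) -> s = t) /\
    (forall s : forall k, F (V k),
       (forall k l (W : opens X) (Wk : W `<=` V k) (Wl : W `<=` V l),
          res (V k) W Wk (s k) = res (V l) W Wl (s l)) ->
       exists t : F U, forall k, res U (V k) (VU k) t = s k).

Section Spaces.
Variable K : closedFieldType.

(* Ringed spaces over K: the structure sheaf is a sheaf of commutative
   K-algebras, with structure maps [cst U]. *)
Record kspace := KSpace {
  pts :> topologicalType;
  reg : opens pts -> comPzRingType;
  res : forall U V : opens pts, V `<=` U -> {rmorphism reg U -> reg V};
  cst : forall U : opens pts, {rmorphism K -> reg U};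
  res_id : forall (U : opens pts) (UU : U `<=` U) s, res UU s = s;
  res_comp : forall (U V W : opens pts) (VU : V `<=` U) (WV : W `<=` V)
    (WU : W `<=` U) s, res WV (res VU s) = res WU s;
  res_cst : forall (U V : opens pts) (VU : V `<=` U) c,
    res VU (cst U c) = cst V c;
  reg_sheaf : sheaf_axiom (fun U V (VU : V `<=` U) => (res VU : reg U -> reg V))
}.

Definition invertible_at (X : kspace) (U : opens X) (s : reg U) (x : X) :=
  exists (V : opens X) (VU : V `<=` U), oset V x /\ invertible (res VU s).

(* Morphisms over K inducing local homomorphisms on stalks. *)
Record kmor (X Y : kspace) := KMor {
  base :> continuous_map X Y;
  comorph : forall V : opens Y, {rmorphism reg V -> reg (preim base V)};
  comorph_res : forall (V W : opens Y) (WV : W `<=` V)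
    (WV' : preim base W `<=` preim base V) s,
    res WV' (comorph V s) = comorph W (res WV s);
  comorph_cst : forall (V : opens Y) c, comorph V (cst V c) = cst _ c;
  comorph_local : forall (V : opens Y) (s : reg V) (x : X),
    oset V (base x) -> invertible_at (comorph V s) x ->
    invertible_at s (base x)
}.

Definition eq_kmor (X Y : kspace) (f g : kmor X Y) :=
  (forall x, f x = g x) /\
  (forall (V : opens Y) (s : reg V) (W : opens X)
          (Wf : W `<=` preim f V) (Wg : W `<=` preim g V),
     res Wf (comorph f V s) = res Wg (comorph g V s)).

Section Identity.
Variable X : kspace.

Definition id_comorph (V : opens X) :
    {rmorphism reg V -> reg (preim (idmap X) V)} :=
  @res X V (preim (idmap X) V) (@sub_refl X V).

Fact id_comorph_res (V W : opens X) (WV : W `<=` V)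
  (WV' : preim (idmap X) W `<=` preim (idmap X) V) s :
  res WV' (id_comorph V s) = id_comorph W (res WV s).
Proof.
by rewrite /id_comorph !(@res_comp X _ _ (preim (idmap X) W) _ _ WV).
Qed.

Fact id_comorph_cst (V : opens X) c : id_comorph V (cst V c) = cst _ c.
Proof. exact: res_cst. Qed.

Fact id_comorph_local (V : opens X) (s : reg V) (x : X) :
  oset V (idmap X x) -> invertible_at (id_comorph V s) x ->
  invertible_at s (idmap X x).
Proof.
move=> _ [W [WV [Wx iW]]]; exists W, WV; split=> //.
by move: iW; rewrite /id_comorph (@res_comp X V (preim (idmap X) V) W _ _ WV).
Qed.

Definition idk : kmor X X :=
  KMor id_comorph_res id_comorph_cst id_comorph_local.

End Identity.

Section Composition.
Variables (X Y Z : kspace) (g : kmor Y Z) (f : kmor X Y).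

Definition comp_comorph (V : opens Z) :
    {rmorphism reg V -> reg (preim (compmap g f) V)} :=
  GRing.RMorphism.clone _ _ (comorph f (preim g V) \o comorph g V) _.

Fact comp_comorph_res (V W : opens Z) (WV : W `<=` V)
  (WV' : preim (compmap g f) W `<=` preim (compmap g f) V) s :
  res WV' (comp_comorph V s) = comp_comorph W (res WV s).
Proof.
rewrite /comp_comorph /=.
by rewrite (comorph_res (preim_sub (f := g) WV)) comorph_res.
Qed.

Fact comp_comorph_cst (V : opens Z) c : comp_comorph V (cst V c) = cst _ c.
Proof. by rewrite /comp_comorph /= !comorph_cst. Qed.

Fact comp_comorph_local (V : opens Z) (s : reg V) (x : X) :
  oset V (compmap g f x) -> invertible_at (comp_comorph V s) x ->
  invertible_at s (compmap g f x).
Proof.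
move=> Vx ix; apply: comorph_local => //.
exact: (@comorph_local _ _ f (preim g V)).
Qed.

Definition compk : kmor X Z :=
  KMor comp_comorph_res comp_comorph_cst comp_comorph_local.

End Composition.

(* U with the induced structure is isomorphic to Spec A for A = reg U: phi is
   a homeomorphism from U onto the set of primes of A with the Zariski
   topology, and the sections over D(f) = {p | f \notin p} are A_f. *)
Definition is_affine (X : kspace) (U : opens X) :=
  exists phi : X -> set (reg U),
    [/\ set_bij U [set p | is_prime p] phi,
        forall W : set X, W `<=` U ->
          (open W <-> exists T : set (reg U),
             W = [set x | oset U x /\ exists2 f, T f & ~ phi x f])
      & forall (f : reg U) (V : opens X) (VU : V `<=` U),
          (V : set X) = [set x | oset U x /\ ~ phi x f] ->
          is_localization_at f (res VU)].

Definition is_scheme (X : kspace) :=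
  forall x : X, exists2 U : opens X, oset U x & is_affine U.

Definition is_stalk (X : kspace) (x : X) (L : comPzRingType) :=
  exists germ : forall U : opens X, oset U x -> {rmorphism reg U -> L},
    [/\ forall (U V : opens X) (VU : V `<=` U) Ux Vx s,
          germ V Vx (res VU s) = germ U Ux s,
        forall l, exists (U : opens X) (Ux : oset U x) (s : reg U),
          germ U Ux s = l
      & forall (U : opens X) (Ux : oset U x) (s : reg U), germ U Ux s = 0 ->
          exists (V : opens X) (VU : V `<=` U), oset V x /\ res VU s = 0].

Definition is_finite_type (X : kspace) :=
  exists n (U : 'I_n -> opens X),
    \bigcup_k (U k : set X) = setT /\
    forall k, is_affine (U k) /\ is_finitely_generated (cst (U k)).

Definition is_closed_immersion (X Y : kspace) (f : kmor X Y) :=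
  [/\ injective f, closed (range f),
      forall W : opens X, exists V : opens Y, (W : set X) = f @^-1` V
    & forall (V : opens Y) (s : reg (preim f V)) (y : Y), oset V y ->
        exists (W : opens Y) (WV : W `<=` V), oset W y /\
        exists t : reg W, comorph f W t = res (preim_sub (f := f) WV) s].

Definition is_open_immersion (X Y : kspace) (f : kmor X Y) :=
  [/\ injective f, forall W : opens X, open (f @` W)
    & forall V : opens Y, V `<=` range f -> bijective (comorph f V)].

Definition is_square (X P : kspace) (p q : kmor P X) :=
  is_scheme P /\
  forall (T : kspace) (f g : kmor T X), is_scheme T ->
    exists h : kmor T P,
      [/\ eq_kmor (compk p h) f, eq_kmor (compk q h) g
        & forall h' : kmor T P,
            eq_kmor (compk p h') f -> eq_kmor (compk q h') g -> eq_kmor h' h].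

(* P is the fibre product X x_K X and d is the diagonal. *)
Definition is_separated (X : kspace) :=
  exists (P : kspace) (p q : kmor P X) (d : kmor X P),
    [/\ is_square p q, eq_kmor (compk p d) (idk X), eq_kmor (compk q d) (idk X)
      & is_closed_immersion d].

(* P is glued from n+1 affine n-spaces U_0, ..., U_n in the usual way; t i j
   is the coordinate x_j / x_i on U_i. *)
Definition is_projective_space n (P : kspace) :=
  exists (U : 'I_n.+1 -> opens P) (t : forall k : 'I_n.+1, 'I_n.+1 -> reg (U k)),
    [/\ \bigcup_k (U k : set P) = setT,
        forall k, [/\ is_affine (U k), t k k = 1
          & is_polynomial_algebra (cst (U k)) (fun l : 'I_n => t k (lift k l))],
        forall k l, (U k : set P) `&` U l =
                    [set x | oset (U k) x /\ invertible_at (t k l) x]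
      & forall k l m (W : opens P) (Wk : W `<=` U k) (Wl : W `<=` U l),
          res Wk (t k l) * res Wl (t l m) = res Wk (t k m)].

Definition is_projective (X : kspace) :=
  exists n (P : kspace) (f : kmor X P),
    is_projective_space n P /\ is_closed_immersion f.

(* Smooth of pure dimension d; K being algebraically closed, this means that
   the local rings at closed points are regular of dimension d. *)
Definition is_smooth d (X : kspace) :=
  [/\ is_scheme X, is_finite_type X, is_separated X
    & forall x : X, closed [set x] ->
        exists2 L, is_stalk x L & is_regular_local L d].

Definition is_irreducible (X : topologicalType) :=
  [set: X] !=set0 /\
  forall U V : set X, open U -> open V -> U !=set0 -> V !=set0 ->
    U `&` V !=set0.

Definition is_smooth_irreducible_projective_curve (X : kspace) :=
  [/\ is_smooth 1 X, is_irreducible X & is_projective X].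

Definition is_smooth_surface (X : kspace) := is_smooth 2 X.

Definition is_reduced (X : kspace) :=
  forall (U : opens X) (s : reg U) n, s ^+ n = 0 -> s = 0.

Definition is_cohen_macaulay (X : kspace) :=
  forall x : X, exists2 L, is_stalk x L & is_cohen_macaulay_local L.

(* f identifies X with the reduced subscheme of Y. *)
Definition is_reduction (X Y : kspace) (f : kmor X Y) :=
  [/\ is_closed_immersion f, range f = setT & is_reduced X].

(* The ideal sheaf of a closed immersion f, and its square. *)
Definition ideal_of (X Y : kspace) (f : kmor X Y) (V : opens Y) :
    set (reg V) :=
  [set s | comorph f V s = 0].
Arguments ideal_of {X Y} f V _.

Definition ideal_sq (X Y : kspace) (f : kmor X Y) (V : opens Y) :
    set (reg V) :=
  [set s | forall y, oset V y ->
     exists (W : opens Y) (WV : W `<=` V), oset W y /\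
     exists n (a b : 'I_n -> reg W),
       [/\ forall k, ideal_of f W (a k), forall k, ideal_of f W (b k)
         & res WV s = \sum_k a k * b k]].
Arguments ideal_sq {X Y} f V _.

(* Every closed point has a neighbourhood which is a locally closed subscheme
   of a smooth surface. *)
Definition locally_in_smooth_surface (Y : kspace) :=
  forall y : Y, closed [set y] ->
    exists (W T S : kspace)
           (u : kmor W Y) (c : kmor W T) (o : kmor T S),
      [/\ is_open_immersion u, range u y, is_closed_immersion c,
          is_open_immersion o & is_smooth_surface S].

(* Y is Cohen-Macaulay with smooth reduced curve C, is locally embeddable in
   smooth surfaces, and has multiplicity 2: 2 is the least n such that the
   n-th power of the ideal of C vanishes. *)
Definition is_primitive_double_curve (C Y : kspace) (i : kmor C Y) :=
  [/\ is_scheme Y /\ is_cohen_macaulay Y,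
      is_smooth_irreducible_projective_curve C /\ is_reduction i,
      locally_in_smooth_surface Y,
      forall U : opens Y, ideal_sq i U = [set 0]
    & exists U : opens Y, ideal_of i U <> [set 0]].

Section Modules.
Variable X : kspace.

Record omodule := OModule {
  sect :> forall U : opens X, lmodType (reg U);
  mres : forall U V : opens X, V `<=` U -> sect U -> sect V;
  mres_linear : forall (U V : opens X) (VU : V `<=` U) a m n,
    mres VU (a *: m + n) = res VU a *: mres VU m + mres VU n;
  mres_id : forall (U : opens X) (UU : U `<=` U) m, mres UU m = m;
  mres_comp : forall (U V W : opens X) (VU : V `<=` U) (WV : W `<=` V)
    (WU : W `<=` U) m, mres WV (mres VU m) = mres WU m;
  mod_sheaf : sheaf_axiom (fun U V (VU : V `<=` U) =>
    (mres VU : sect U -> sect V))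
}.

Record ohom (M N : omodule) := OHom {
  ohom_fun :> forall U : opens X, {linear M U -> N U};
  ohom_res : forall (U V : opens X) (VU : V `<=` U) m,
    mres VU (ohom_fun U m) = ohom_fun V (mres VU m)
}.

(* Locally free of finite rank. *)
Definition is_vector_bundle (M : omodule) :=
  forall x : X, exists (U : opens X) (n : nat) (e : 'I_n -> M U),
    oset U x /\
    forall (V : opens X) (VU : V `<=` U) (m : M V),
      exists! c : {ffun 'I_n -> reg V}, m = \sum_k c k *: mres VU (e k).

(* Short exact sequences 0 -> N -> mid -> M -> 0. Since taking sections is left
   exact, only the surjectivity is local. *)
Record extension (M N : omodule) := Extension {
  mid : omodule;
  incl : ohom N mid;
  proj : ohom mid M;
  incl_inj : forall U : opens X, injective (incl U);
  ext_exact : forall (U : opens X) (m : mid U),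
    proj U m = 0 <-> exists n : N U, incl U n = m;
  proj_surj : forall (U : opens X) (m : M U) (x : X), oset U x ->
    exists (V : opens X) (VU : V `<=` U), oset V x /\
    exists s : mid V, proj V s = mres VU m
}.

Definition id_ohom (M : omodule) : ohom M M :=
  @OHom M M (fun U => GRing.Linear.clone _ _ _ _ (@idfun (M U)) _)
    (fun U V VU m => erefl).

Section CompositionHom.
Variables (M N P : omodule) (g : ohom N P) (f : ohom M N).

Definition comp_ohom_fun (U : opens X) : {linear M U -> P U} :=
  GRing.Linear.clone _ _ _ _ (g U \o f U) _.

Fact comp_ohom_res (U V : opens X) (VU : V `<=` U) m :
  mres VU (comp_ohom_fun U m) = comp_ohom_fun V (mres VU m).
Proof. by rewrite /comp_ohom_fun /= !ohom_res. Qed.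

Definition comp_ohom : ohom M P := OHom comp_ohom_res.

End CompositionHom.

Section Ext.
Variables M N : omodule.
Implicit Types F G H : extension M N.

Definition ext_equiv F G :=
  exists phi : ohom (mid F) (mid G),
    [/\ forall U : opens X, bijective (phi U),
        forall (U : opens X) n, phi U (incl F U n) = incl G U n
      & forall (U : opens X) m, proj G U (phi U m) = proj F U m].

Lemma ext_equiv_refl F : ext_equiv F F.
Proof. by exists (id_ohom (mid F)); split=> // U; exists id. Qed.

Lemma ext_equiv_trans F G H : ext_equiv F G -> ext_equiv G H -> ext_equiv F H.
Proof.
move=> [phi [bphi iphi pphi]] [psi [bpsi ipsi ppsi]].
exists (comp_ohom psi phi); split=> [U|U n|U m] /=.
- exact: (bij_comp (bpsi U) (bphi U)).
- by rewrite iphi ipsi.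
- by rewrite ppsi pphi.
Qed.

(* Ext^1(M, N) is the set of equivalence classes of extensions. The classes are
   predicates rather than [set]s for universe reasons. *)
Record Ext1 := MkExt1 {
  ext_mem :> extension M N -> Prop;
  ext_memP : exists F, ext_mem = ext_equiv F
}.

Lemma Ext1_eq (c d : Ext1) : ext_mem c = ext_mem d -> c = d.
Proof.
case: c d => [c cP] [d dP] /= e; move: cP; rewrite e => cP.
by congr MkExt1; exact: Prop_irrelevance.
Qed.

Definition ext_class F : Ext1 := MkExt1 (ex_intro _ F erefl).

(* H is the Baer sum of F and G: there is a morphism from the fibre product of
   F and G over M to H which induces the sum on N x N and the identity on M. *)
Definition is_baer_sum F G H :=
  exists theta : forall U : opens X, mid F U -> mid G U -> mid H U,
    [/\ forall (U : opens X) a s s' t t',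
          proj F U s = proj G U t -> proj F U s' = proj G U t' ->
          theta U (a *: s + s') (a *: t + t') =
          a *: theta U s t + theta U s' t',
        forall (U V : opens X) (VU : V `<=` U) s t,
          proj F U s = proj G U t ->
          mres VU (theta U s t) = theta V (mres VU s) (mres VU t),
        forall (U : opens X) n n',
          theta U (incl F U n) (incl G U n') = incl H U (n + n')
      & forall (U : opens X) s t, proj F U s = proj G U t ->
          proj H U (theta U s t) = proj F U s].

(* H is the pushout of F along multiplication by the scalar a on N. *)
Definition is_scaled (a : K) F H :=
  exists theta : ohom (mid F) (mid H),
    (forall (U : opens X) n,
       theta U (incl F U n) = incl H U (cst U a *: n)) /\
    (forall (U : opens X) s, proj H U (theta U s) = proj F U s).

(* The graphs of the K-vector space operations of Ext^1(M, N): e = c + d, and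
   e = a c. A Baer sum and a pushout as above exist and are unique up to
   equivalence. *)
Definition ext_add (c d e : Ext1) :=
  exists F G H, [/\ c F, d G, e H & is_baer_sum F G H].

Definition ext_scale (a : K) (c e : Ext1) :=
  exists F H, [/\ c F, e H & is_scaled a F H].

End Ext.
End Modules.

Section Pushforward.
Variables (X Y : kspace) (f : kmor X Y).

Section PushModule.
Variable M : omodule X.

Definition push_sect (V : opens Y) : lmodType (reg V) :=
  restr (comorph f V) (M (preim f V)).

Definition push_res (U V : opens Y) (VU : V `<=` U) :
    push_sect U -> push_sect V :=
  mres (preim_sub (f := f) VU).

Fact push_res_linear (U V : opens Y) (VU : V `<=` U) a m n :
  push_res VU (a *: m + n) = res VU a *: push_res VU m + push_res VU n.
Proof.
rewrite /push_res [LHS]mres_linear.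
by rewrite (comorph_res VU).
Qed.

Fact push_res_id (U : opens Y) (UU : U `<=` U) m : push_res UU m = m.
Proof. exact: mres_id. Qed.

Fact push_res_comp (U V W : opens Y) (VU : V `<=` U) (WV : W `<=` V)
  (WU : W `<=` U) m : push_res WV (push_res VU m) = push_res WU m.
Proof. exact: mres_comp. Qed.

Fact push_sheaf : sheaf_axiom (fun U V (VU : V `<=` U) =>
  (push_res VU : push_sect U -> push_sect V)).
Proof.
move=> U I V VU UV.
have sub : (preim f U : set X) `<=` \bigcup_k preim f (V k).
  by move=> x /UV[k _ Vx]; exists k.
have [sep glue] :=
  @mod_sheaf X M _ _ _ (fun k => preim_sub (f := f) (VU k)) sub.
split=> [s t|s st]; first exact: sep.
have [k l W Wk Wl|t ht] := glue s; last by exists t.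
pose VI := Opens (openI (oset_open (V k)) (oset_open (V l))).
have WI : W `<=` preim f VI by move=> x Wx; split; [exact: Wk|exact: Wl].
have Ik : VI `<=` V k by move=> y [].
have Il : VI `<=` V l by move=> y [].
have := congr1 (mres WI) (st k l VI Ik Il).
by rewrite /push_res !(mres_comp _ WI).
Qed.

Definition push : omodule Y :=
  OModule push_res_linear push_res_id push_res_comp push_sheaf.

End PushModule.
Section PushHom.
Variables (M N : omodule X) (g : ohom M N).

Definition push_hom_fun (V : opens Y) : push M V -> push N V := g (preim f V).

Fact push_hom_linear (V : opens Y) : linear (@push_hom_fun V).
Proof. by move=> a m n; rewrite /push_hom_fun [LHS]linearP. Qed.

HB.instance Definition _ (V : opens Y) :=
  GRing.isLinear.Build (reg V) (push M V) (push N V) *:%R (@push_hom_fun V)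
    (@push_hom_linear V).

Fact push_hom_res (U V : opens Y) (VU : V `<=` U) m :
  mres VU (@push_hom_fun U m) = @push_hom_fun V (mres VU m).
Proof. exact: (ohom_res g (preim_sub (f := f) VU)). Qed.

Definition push_hom : ohom (push M) (push N) :=
  @OHom Y (push M) (push N)
    (fun V => GRing.Linear.clone _ _ _ _ (@push_hom_fun V) _) push_hom_res.

End PushHom.

(* The pushforward along a closed immersion is exact. *)
Section PushExtension.
Hypothesis fP : is_closed_immersion f.
Variables M N : omodule X.

Section Extension.
Variable F : extension M N.

Fact push_incl_inj (V : opens Y) : injective (push_hom (incl F) V).
Proof. exact: incl_inj. Qed.

Fact push_exact (V : opens Y) (m : push (mid F) V) :
  push_hom (proj F) V m = 0 <-> exists n : push N V, push_hom (incl F) V n = m.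
Proof. exact: (@ext_exact _ _ _ F (preim f V) m). Qed.

Fact push_proj_surj (V : opens Y) (m : push M V) (y : Y) : oset V y ->
  exists (W : opens Y) (WV : W `<=` V), oset W y /\
  exists s : push (mid F) W, push_hom (proj F) W s = mres WV m.
Proof.
case: fP => finj fcl find _ Vy.
have [[x _ fx]|nfy] := pselect (range f y).
- have Vx : oset (preim f V) x by rewrite /= /preimage fx.
  have [W [WV [Wx [s hs]]]] := proj_surj F m Vx.
  have [W' eW] := find W.
  pose T := Opens (openI (oset_open W') (oset_open V)).
  have TV : T `<=` V by move=> z [].
  have TW : preim f T `<=` W by move=> z [Wz _]; rewrite eW.
  exists T, TV; split.
    split; last by rewrite -fx.
    by move: Wx; rewrite -/(oset W x) eW /preimage /= fx.
  exists (mres TW s : push (mid F) T).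
  rewrite /= /push_hom_fun -ohom_res hs.
  exact: mres_comp.
- pose T := Opens (openI (closed_openC fcl) (oset_open V)).
  have TV : T `<=` V by move=> z [].
  exists T, TV; split=> //.
  exists 0.
  have T0 (z : X) : ~ oset (preim f T) z by move=> [nz _]; apply: nz; exists z.
  have [sep _] := @mod_sheaf X M (preim f T) False (fun k => False_rect _ k)
    (fun k => False_ind _ k) (fun z Tz => False_ind _ (T0 z Tz)).
  by refine (sep _ _ _); case.
Qed.

Definition push_ext : extension (push M) (push N) :=
  Extension push_incl_inj push_exact push_proj_surj.

End Extension.

Lemma push_ext_equiv (F G : extension M N) :
  ext_equiv F G -> ext_equiv (push_ext F) (push_ext G).
Proof.
move=> [phi [bphi iphi pphi]]; exists (push_hom phi).
split=> [V|V n|V m]; [exact: bphi|exact: iphi|exact: pphi].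
Qed.

Definition push_class_mem (c : Ext1 M N) (G : extension (push M) (push N)) :=
  exists F, c F /\ ext_equiv (push_ext F) G.

Fact push_class_memP (c : Ext1 M N) :
  exists F, push_class_mem c = ext_equiv F.
Proof.
have [F cF] := ext_memP c; exists (push_ext F).
apply: funext => G; apply: propext; split=> [[H []]|FG].
  by rewrite cF => /push_ext_equiv; exact: ext_equiv_trans.
by exists F; rewrite cF; split=> //; exact: ext_equiv_refl.
Qed.

(* The canonical map Ext^1(M, N) -> Ext^1(f_* M, f_* N), which sends the class
   of F to the class of f_* F. *)
Definition push_class (c : Ext1 M N) : Ext1 (push M) (push N) :=
  MkExt1 (push_class_memP c).

Lemma push_classE (F : extension M N) :
  push_class (ext_class F) = ext_class (push_ext F).
Proof.
apply: Ext1_eq; apply: funext => G; apply: propext; split=> [[H []]|FG].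
  by move=> /push_ext_equiv; exact: ext_equiv_trans.
by exists F; split=> //; exact: ext_equiv_refl.
Qed.

End PushExtension.
End Pushforward.
End Spaces.

Arguments ideal_of {K X Y} f V _.
Arguments ideal_sq {K X Y} f V _.
Arguments push_class {K X Y f} fP {M N} c.

(* Main.v *)
Require Import Defs.
From HB Require Import structures.
From mathcomp Require Import all_boot all_order all_algebra.
From mathcomp Require Import complex.
From mathcomp Require Import all_classical all_reals topology.

Set Implicit Arguments.
Unset Strict Implicit.
Unset Printing Implicit Defensive.

Local Open Scope classical_set_scope.
Local Open Scope ring_scope.

(* Write I for the ideal sheaf of C in S. In an extension F of E by E over O_S
   both ends are killed by I, so F is killed by I^2, which is the ideal sheaf of
   C2. Pushforward along a closed immersion j is fully faithful and its essential
   image consists of the modules killed by the ideal sheaf of j, so F and all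
   morphisms of extensions come from C2. *)

Import GRing.Theory Defs.

(** * Modules and extensions on a single space *)

Lemma opens_ext (X : topologicalType) (U V : opens X) :
  (U : set X) = V -> U = V.
Proof.
case: U V => [U oU] [V oV] /= UV; case: _ / UV oV => oV.
by rewrite (Prop_irrelevance oU oV).
Qed.

Section ModulesOnASpace.
Variables (K : closedFieldType) (X : kspace K).

(** The empty family covers U, and separation with respect to it holds vacuously. *)
Lemma reg_empty (U : opens X) (s t : reg U) : (forall x, ~ oset U x) -> s = t.
Proof.
move=> U0; have [sep _] := @reg_sheaf _ X U False (fun k => False_rect _ k)
  (fun k => False_ind _ k) (fun x Ux => False_ind _ (U0 x Ux)).
by apply: sep; case.
Qed.

Lemma sect_local (M : omodule X) (U : opens X) (m n : M U) :
  (forall x, oset U x -> exists (V : opens X) (VU : V `<=` U),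
     oset V x /\ mres VU m = mres VU n) -> m = n.
Proof.
move=> mn.
(* The cover consists of all opens on which m and n agree, so no neighbourhood has to be chosen for
   each point. *)
pose I := {V : opens X | exists VU : V `<=` U, mres VU m = mres VU n}.
have IU (k : I) : sval k `<=` U by case: k => V [].
have [sep _] : _ /\ _ := @mod_sheaf _ X M U I (fun k => sval k) IU
  (fun x Ux => let: ex_intro V (ex_intro VU (conj Vx e)) := mn x Ux in
     ex_intro2 _ _ (exist _ V (ex_intro _ VU e) : I) Logic.I Vx).
apply: sep => k; case: k (IU k) => V [VU e] /= VU'.
by rewrite (Prop_irrelevance VU' VU).
Qed.

Lemma mresD (M : omodule X) (U V : opens X) (VU : V `<=` U) (m n : M U) :
  mres VU (m + n) = mres VU m + mres VU n.
Proof. by rewrite -[m]scale1r mres_linear rmorph1 !scale1r. Qed.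

Lemma mres_scale (M : omodule X) (U V : opens X) (VU : V `<=` U) a (m : M U) :
  mres VU (a *: m) = res VU a *: mres VU m.
Proof.
have mres0 : mres VU (0 : M U) = 0.
  by apply/(addrI (mres VU 0)); rewrite -mresD !addr0.
by rewrite -[a *: m]addr0 mres_linear mres0 addr0.
Qed.

Definition mk_linear (A : pzRingType) (M N : lmodType A) (phi : M -> N)
    (phi_linear : linear phi) : {linear M -> N} :=
  HB.pack phi (GRing.isLinear.Build A M N *:%R phi phi_linear).

Definition mk_ohom (M N : omodule X) (phi : forall U : opens X, M U -> N U)
    (phi_linear : forall U, linear (phi U))
    (phi_res : forall (U V : opens X) (VU : V `<=` U) m,
       mres VU (phi U m) = phi V (mres VU m)) : ohom M N :=
  @OHom _ X M N (fun U => mk_linear (phi_linear U)) phi_res.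

Lemma inverse_ohom (M N : omodule X) (phi : ohom M N) :
  (forall U, bijective (phi U)) ->
  exists psi : ohom N M,
    forall U, cancel (phi U) (psi U) /\ cancel (psi U) (phi U).
Proof.
move=> phi_bij.
have /all_sig[g gK] U : {g : N U -> M U | cancel (phi U) g /\ cancel g (phi U)}.
  by apply: cid; case: (phi_bij U) => g; exists g.
have phiK U := (gK U).1; have {}gK U := (gK U).2.
have g_linear U : linear (g U).
  by move=> a m n; apply: (can_inj (phiK U)); rewrite linearP !gK.
have g_res (U V : opens X) (VU : V `<=` U) m : mres VU (g U m) = g V (mres VU m).
  by apply: (can_inj (phiK V)); rewrite -ohom_res !gK.
exists (mk_ohom g_linear g_res) => U; split; [exact: phiK|exact: gK].
Qed.

Lemma ext_equiv_sym (M N : omodule X) (F G : extension M N) :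
  ext_equiv F G -> ext_equiv G F.
Proof.
move=> [phi [phi_bij phi_incl phi_proj]].
have [psi psiK] := inverse_ohom phi_bij; exists psi; split=> [U|U n|U m].
- by have [phiK psi_phi] := psiK U; exists (phi U).
- by rewrite -phi_incl (psiK U).1.
- by rewrite -phi_proj (psiK U).2.
Qed.

Lemma eq_ext_class (M N : omodule X) (F G : extension M N) :
  ext_class F = ext_class G <-> ext_equiv F G.
Proof.
split=> [e|FG].
  have : ext_mem (ext_class G) G by exact: ext_equiv_refl.
  by rewrite -e.
apply: Ext1_eq; apply: funext => H; apply: propext; split.
  exact: ext_equiv_trans (ext_equiv_sym FG).
exact: ext_equiv_trans.
Qed.

Lemma Ext1_class (M N : omodule X) (c : Ext1 M N) : exists F, c = ext_class F.
Proof. by have [F cF] := ext_memP c; exists F; apply: Ext1_eq. Qed.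

Lemma proj_incl (M N : omodule X) (F : extension M N) (U : opens X) (n : N U) :
  proj F U (incl F U n) = 0.
Proof. by apply/ext_exact; exists n. Qed.

(** The map theta of the Baer sum is precomposed with F -> F' and G -> G' and postcomposed with H'
    -> H, which explains the direction of the third equivalence. *)
Lemma baer_sum_equiv (M N : omodule X) (F F' G G' H H' : extension M N) :
  ext_equiv F F' -> ext_equiv G G' -> ext_equiv H' H ->
  is_baer_sum F' G' H' -> is_baer_sum F G H.
Proof.
move=> [f [_ f_incl f_proj]] [g [_ g_incl g_proj]] [h [_ h_incl h_proj]].
move=> [theta [theta_lin theta_res theta_incl theta_proj]].
exists (fun U s t => h U (theta U (f U s) (g U t))).
split=> [U a s s' t t' st st'|U V VU s t st|U n n'|U s t st].
- by rewrite !linearP theta_lin ?linearP // f_proj g_proj.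
- by rewrite ohom_res theta_res ?ohom_res // f_proj g_proj.
- by rewrite f_incl g_incl theta_incl h_incl.
- by rewrite h_proj theta_proj f_proj // g_proj.
Qed.

Lemma scaled_equiv (M N : omodule X) (a : K) (F F' H H' : extension M N) :
  ext_equiv F F' -> ext_equiv H' H -> is_scaled a F' H' -> is_scaled a F H.
Proof.
move=> [f [_ f_incl f_proj]] [h [_ h_incl h_proj]] [theta [th_incl th_proj]].
exists (comp_ohom h (comp_ohom theta f)); split=> [U n|U s] /=.
  by rewrite f_incl th_incl h_incl.
by rewrite h_proj th_proj f_proj.
Qed.

End ModulesOnASpace.

(** * Full faithfulness of pushforward along a closed immersion *)

Section ClosedImmersion.
Variables (K : closedFieldType) (X Y : kspace K) (f : kmor X Y).
Hypothesis fP : is_closed_immersion f.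

(** If U is the preimage of V, a point of the image of f satisfies the condition exactly when it
    lies in V, and a point off the closed image satisfies it vacuously. *)
Lemma push_open_subproof (U : opens X) :
  open [set y | forall x, f x = y -> oset U x].
Proof.
have [f_inj f_closed f_opens _] := fP; have [V UV] := f_opens U.
suff -> : [set y | forall x, f x = y -> oset U x] = (V : set Y) `|` ~` range f.
  exact: openU (oset_open V) (closed_openC f_closed).
apply/seteqP; split=> y /=.
  move=> Uy; have [[x _ fx]|nfy] := pselect (range f y); last by right.
  by left; have := Uy x fx; rewrite -[oset U x]/((U : set X) x) UV /preimage /= fx.
case=> [Vy x fx|nfy x fx]; last by case: nfy; exists x.
by rewrite -[oset U x]/((U : set X) x) UV /preimage /= fx.
Qed.

(* The largest open subset of Y with inverse image U. *)
Definition push_open (U : opens X) : opens Y := Opens (push_open_subproof U).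

Lemma push_openS (U V : opens X) : V `<=` U -> push_open V `<=` push_open U.
Proof. by move=> VU y Vy x fx; apply: VU; exact: Vy. Qed.

(** Together with [preim_push_open] this makes [push_open] right adjoint to [preim f]. *)
Lemma sub_push_open (U : opens X) (V : opens Y) :
  preim f V `<=` U -> V `<=` push_open U.
Proof. by move=> VU y Vy x fx; apply: VU; rewrite /= /preimage /= fx. Qed.

Lemma preim_push_open (U : opens X) : preim f (push_open U) = U.
Proof.
have [f_inj _ _ _] := fP; apply: opens_ext; apply/seteqP.
split=> x /= Ux; first exact: Ux.
by move=> x' /f_inj->.
Qed.

Lemma preim_push_openS (U : opens X) : preim f (push_open U) `<=` U.
Proof. by rewrite preim_push_open. Qed.

(* Off the image of f, the sections over the preimage form the zero ring. *)
Lemma comorph_local_lift (U : opens X) (s : reg U) (y : Y) :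
  oset (push_open U) y ->
  exists (V : opens Y) (VU : preim f V `<=` U),
    oset V y /\ exists t : reg V, comorph f V t = res VU s.
Proof.
move=> Uy; have [f_inj f_closed _ f_lift] := fP.
have [[x _ fx]|nfy] := pselect (range f y).
  have [W [WV [Wy [t ht]]]] := f_lift _ (res (@preim_push_openS U) s) y Uy.
  have WU : preim f W `<=` U by move=> z /WV; exact: preim_push_openS.
  by exists W, WU; split=> //; exists t; rewrite ht (res_comp _ _ WU).
pose V := Opens (closed_openC f_closed).
have V0 x : ~ oset (preim f V) x by move=> nfx; apply: nfx; exists x.
have VU : preim f V `<=` U by move=> x Vx; case: (V0 x).
by exists V, VU; split=> //; exists 0; exact: reg_empty.
Qed.

Lemma comorph_local_lift2 (U : opens X) (s s' : reg U) (y : Y) :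
  oset (push_open U) y ->
  exists (V : opens Y) (VU : preim f V `<=` U),
    oset V y /\ exists t t' : reg V,
      comorph f V t = res VU s /\ comorph f V t' = res VU s'.
Proof.
move=> Uy; have [V [VU [Vy [t ht]]]] := comorph_local_lift s Uy.
have [V' [VU' [Vy' [t' ht']]]] := comorph_local_lift s' Uy.
pose W := Opens (openI (oset_open V) (oset_open V')).
have WV : W `<=` V by move=> z [].
have WV' : W `<=` V' by move=> z [].
have WU : preim f W `<=` U by move=> z /WV; exact: VU.
exists W, WU; split=> //; exists (res WV t), (res WV' t').
rewrite -!(comorph_res _ (preim_sub (f := f) _)) ht ht'.
by rewrite !(res_comp _ _ WU).
Qed.

(** Equality over X can be tested near points of Y, where scalars from X lift to Y. Injectivity of f
    puts f x in [push_open U] for every x in U. *)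
Lemma push_sect_local (M : omodule X) (U : opens X) (m n : M U) :
  (forall y, oset (push_open U) y ->
     exists (V : opens Y) (VU : preim f V `<=` U),
       oset V y /\ mres VU m = mres VU n) -> m = n.
Proof.
move=> mn; apply: sect_local => x Ux.
have [|V [VU [Vx e]]] := mn (f x).
  by move=> x' fx; have [f_inj _ _ _] := fP; rewrite (f_inj _ _ fx).
by exists (preim f V), VU.
Qed.

(** Every open U of X is the preimage of [push_open U], so phi over the latter determines psi over
    U. Linearity over the structure sheaf of X follows from that over Y, because scalars on X lift
    locally along f. *)
Lemma push_full (M N : omodule X) (phi : ohom (push f M) (push f N)) :
  exists psi : ohom M N,
    forall (V : opens Y) (m : push f M V), psi (preim f V) m = phi V m.
Proof.
have UE (U : opens X) : U `<=` preim f (push_open U).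
  by rewrite preim_push_open.
pose psi U (m : M U) : N U :=
  (* The two restrictions run between equal opens and replace transports along [preim_push_open]. *)
  mres (UE U) (phi (push_open U) (mres (@preim_push_openS U) m)).
have psi_res (U : opens X) (V : opens Y) (VU : preim f V `<=` U) m :
    mres VU (psi U m) = phi V (mres VU m : push f M V).
  rewrite /psi (mres_comp _ _ (preim_sub (f := f) (sub_push_open VU))).
  rewrite -[LHS]/(@mres _ _ (push f N) _ _ (sub_push_open VU) (phi _ _)).
  rewrite ohom_res.
  by congr (phi V _); exact: (mres_comp _ _ VU).
have psi_linear U : linear (psi U).
  move=> a m n; apply: push_sect_local => y Uy.
  have [V [VU [Vy [t ht]]]] := comorph_local_lift a Uy.
  exists V, VU; split=> //; rewrite psi_res !mres_linear !psi_res -ht.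
  exact: (linearP (phi V) t (mres VU m : push f M V) (mres VU n)).
have psi_res' (U V : opens X) (VU : V `<=` U) m :
    mres VU (psi U m) = psi V (mres VU m).
  apply: push_sect_local => y Vy; exists (push_open V), (@preim_push_openS V).
  split=> //; have VU' := subset_trans (@preim_push_openS V) VU.
  by rewrite psi_res !(mres_comp _ _ VU') psi_res.
exists (mk_ohom psi_linear psi_res') => V m.
by have := psi_res _ V (@sub_refl _ _) m; rewrite !mres_id.
Qed.

(** * Equivalences, Baer sums and scalings under pushforward *)

Lemma preim_surj (U : opens X) : exists V : opens Y, U = preim f V.
Proof. by exists (push_open U); rewrite preim_push_open. Qed.

Lemma push_baer_sum (M N : omodule X) (F G H : extension M N) :
  is_baer_sum F G H ->
  is_baer_sum (push_ext fP F) (push_ext fP G) (push_ext fP H).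
Proof.
move=> [theta [th_lin th_res th_incl th_proj]].
exists (fun V => theta (preim f V)); split.
- by move=> V a s s' t t'; exact: th_lin.
- by move=> U V VU s t; exact: th_res.
- by move=> V n n'; exact: th_incl.
- by move=> V s t; exact: th_proj.
Qed.

Lemma push_scaled (M N : omodule X) (a : K) (F H : extension M N) :
  is_scaled a F H -> is_scaled a (push_ext fP F) (push_ext fP H).
Proof.
move=> [theta [th_incl th_proj]]; exists (push_hom f theta).
split=> [V n|V s]; last exact: th_proj.
rewrite [LHS]th_incl -comorph_cst; reflexivity.
Qed.

Lemma push_ext_equivP (M N : omodule X) (F G : extension M N) :
  ext_equiv (push_ext fP F) (push_ext fP G) -> ext_equiv F G.
Proof.
move=> [phi [phi_bij phi_incl phi_proj]].
have [psi psiE] := push_full phi; exists psi; split=> U; have [V ->] := preim_surj U.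
- have [g phiK gK] := phi_bij V.
  by exists g => m; rewrite psiE; [exact: phiK|exact: gK].
- by move=> n; rewrite psiE; exact: phi_incl.
- by move=> m; rewrite psiE; exact: phi_proj.
Qed.

Lemma push_scaledP (M N : omodule X) (a : K) (F H : extension M N) :
  is_scaled a (push_ext fP F) (push_ext fP H) -> is_scaled a F H.
Proof.
move=> [theta [th_incl th_proj]].
have [psi psiE] := push_full theta; exists psi; split=> U; have [V ->] := preim_surj U.
- by move=> n; rewrite psiE -comorph_cst; exact: th_incl.
- by move=> s; rewrite psiE; exact: th_proj.
Qed.

(** Since theta is controlled only on pairs with the same image in M, it is not a morphism of
    modules to which [push_full] applies. The same construction is repeated, carrying the equality
    of projections along. *)
Lemma push_baer_sumP (M N : omodule X) (F G H : extension M N) :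
  is_baer_sum (push_ext fP F) (push_ext fP G) (push_ext fP H) ->
  is_baer_sum F G H.
Proof.
move=> [theta [th_lin th_res th_incl th_proj]].
have UE (U : opens X) : U `<=` preim f (push_open U).
  by rewrite preim_push_open.
pose psi U (s : mid F U) (t : mid G U) : mid H U :=
  mres (UE U) (theta (push_open U) (mres (@preim_push_openS U) s)
                                   (mres (@preim_push_openS U) t)).
have proj_res (U V : opens X) (VU : V `<=` U) (s : mid F U) (t : mid G U) :
    proj F U s = proj G U t -> proj F V (mres VU s) = proj G V (mres VU t).
  by move=> st; rewrite -!ohom_res st.
have psi_res (U : opens X) (V : opens Y) (VU : preim f V `<=` U) s t :
    proj F U s = proj G U t ->
    mres VU (psi U s t) = theta V (mres VU s) (mres VU t).
  move=> st; rewrite /psi (mres_comp _ _ (preim_sub (f := f) (sub_push_open VU))).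
  rewrite -[LHS]/(@mres _ _ (push f (mid H)) _ _ (sub_push_open VU)
    (theta _ _ _)).
  rewrite th_res; last exact: proj_res.
  by congr (theta V _ _); exact: (mres_comp _ _ VU).
have psiE (V : opens Y) s t : proj F _ s = proj G _ t ->
    psi (preim f V) s t = theta V s t.
  by move=> st; have := psi_res _ V (@sub_refl _ _) s t st; rewrite !mres_id.
exists psi; split.
- move=> U a s s' t t' st st'; apply: push_sect_local => y Uy.
  have [V [VU [Vy [b hb]]]] := comorph_local_lift a Uy.
  exists V, VU; split=> //.
  rewrite mres_linear !psi_res // ?linearP ?st ?st' // !mres_linear -hb.
  by apply: th_lin; exact: proj_res.
- move=> U V VU s t st; apply: push_sect_local => y Vy.
  exists (push_open V), (@preim_push_openS V); split=> //.
  have VU' := subset_trans (@preim_push_openS V) VU.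
  rewrite (mres_comp _ _ VU') !psi_res ?(mres_comp _ _ VU') //; exact: proj_res.
- move=> U; have [V ->] := preim_surj U => n n'; rewrite psiE; first exact: th_incl.
  by rewrite !proj_incl.
- move=> U; have [V ->] := preim_surj U => s t st.
  by rewrite psiE //; exact: th_proj.
Qed.

End ClosedImmersion.

Arguments push_openS {K X Y f} fP {U V} VU.

(** * Descent of modules killed by the ideal sheaf *)

Section Descent.
Variables (K : closedFieldType) (X Y : kspace K) (f : kmor X Y).
Hypothesis fP : is_closed_immersion f.
Variable G : omodule Y.
Hypothesis G_killed : forall (V : opens Y) (t : reg V) (m : G V),
  ideal_of f V t -> t *: m = 0.

(** When V misses the image of f, the ideal over V contains 1, so the sections of G over V
    vanish. *)
Lemma killed_off_range (V : opens Y) (m n : G V) :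
  (forall x, ~ oset (preim f V) x) -> m = n.
Proof.
move=> V0; have I1 : ideal_of f V 1 by exact: reg_empty.
by rewrite -(scale1r m) -(scale1r n) !G_killed.
Qed.

(** V is covered by W and by the part of V off the image of f. As G vanishes on the second member, a
    section over W extends uniquely to V. *)
Lemma killed_res_bij (V W : opens Y) (WV : W `<=` V) :
  preim f V `<=` preim f W -> bijective (mres WV : G V -> G W).
Proof.
move=> VW; have off_open : open (~` range f).
  by case: fP => _ /closed_openC.
pose U (b : bool) := if b then W else Opens (openI (oset_open V) off_open).
have UV b : U b `<=` V by case: b => // y [].
have cover : (V : set Y) `<=` \bigcup_b U b.
  move=> y Vy; have [[x _ fx]|nfy] := pselect (range f y); last by exists false.
  by exists true => //=; rewrite -fx; apply: VW; rewrite /= /preimage /= fx.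
have off (A : opens Y) (m n : G A) : A `<=` U false -> m = n.
  by move=> A0; apply: killed_off_range => x /A0[_]; apply; exists x.
have [sep glue] := @mod_sheaf _ Y G _ _ U UV cover.
have res_inj : injective (mres WV : G V -> G W).
  move=> m n mn; apply: sep => -[]; last exact: off.
  by rewrite (Prop_irrelevance (UV true) WV).
have /all_sig[g gK] n : {m : G V | mres WV m = n}.
  apply: cid; pose s b : G (U b) := match b with true => n | false => 0 end.
  have [|m hm] := glue s.
    (* Only the pair formed of W with itself is a real condition; the other overlaps miss the image
       of f. *)
    move=> [] [] A Ak Al; try by apply: off.
    by rewrite (Prop_irrelevance Ak Al).
  by exists m; rewrite -[RHS](hm true) (Prop_irrelevance (UV true) WV).
by exists g => // m; apply: res_inj; rewrite gK.
Qed.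

(** The difference of two lifts of a scalar lies in the ideal. Hence scalars on X act on G through
    any local lift. *)
Lemma eq_comorph_scale (V : opens Y) (t t' : reg V) (m : G V) :
  comorph f V t = comorph f V t' -> t *: m = t' *: m.
Proof.
move=> tt'; apply/eqP; rewrite -subr_eq0 -scalerBl G_killed //.
by rewrite /ideal_of /= rmorphB tt' subrr.
Qed.

Lemma descent_local (U : opens X) (m n : G (push_open fP U)) :
  (forall y, oset (push_open fP U) y ->
     exists (V : opens Y) (VU : preim f V `<=` U), oset V y /\
       mres (sub_push_open fP VU) m = mres (sub_push_open fP VU) n) -> m = n.
Proof.
move=> mn; apply: sect_local => y Uy; have [V [VU [Vy e]]] := mn y Uy.
by exists V, (sub_push_open fP VU).
Qed.

(** The products of m by local lifts of s glue by [eq_comorph_scale]. The cover is indexed by all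
    local lifts, so the formula holds for each of them and not just for chosen ones. *)
Lemma descent_scale_exists (U : opens X) (s : reg U) (m : G (push_open fP U)) :
  exists n : G (push_open fP U),
    forall (V : opens Y) (VU : preim f V `<=` U) (t : reg V),
      comorph f V t = res VU s ->
      mres (sub_push_open fP VU) n = t *: mres (sub_push_open fP VU) m.
Proof.
pose I := {V : opens Y & {t : reg V |
  exists VU : preim f V `<=` U, comorph f V t = res VU s}}.
have IU (k : I) : projT1 k `<=` push_open fP U.
  by case: k => V [t tP] /=; apply: sub_push_open; case: tP.
have cover : (push_open fP U : set Y) `<=` \bigcup_(k : I) projT1 k.
  move=> y Uy; have [V [VU [Vy [t ht]]]] := comorph_local_lift s Uy.
  by exists (existT _ V (exist _ t (ex_intro _ VU ht))).
have [_ glue] := @mod_sheaf _ Y G _ I (fun k => projT1 k) IU cover.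
have [|n hn] := glue (fun k : I => sval (projT2 k) *: mres (IU k) m).
  move=> [V [t tP]] [V' [t' tP']] W /= WV WV'.
  move: (IU _) (IU _) => ? ?.
  have [VU ht] := tP; have [VU' ht'] := tP'.
  have WU : preim f W `<=` U by move=> x /WV; exact: VU.
  rewrite !mres_scale !(mres_comp _ _ (sub_push_open fP WU)).
  apply: eq_comorph_scale; rewrite -!(comorph_res _ (preim_sub (f := f) _)).
  by rewrite ht ht' !(res_comp _ _ WU).
exists n => V VU t ht.
pose k : I := existT _ V (exist _ t (ex_intro _ VU ht)).
by have := hn k; rewrite (Prop_irrelevance (IU k) (sub_push_open fP VU)).
Qed.

(** This is the inverse image of G, obtained without sheafification: by [killed_res_bij], the
    sections of G over an open of Y depend only on its preimage, so the largest open with preimage U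
    may represent them. *)
Definition descent_sect (U : opens X) : Type := G (push_open fP U).

HB.instance Definition _ (U : opens X) := GRing.Zmodule.on (descent_sect U).

Section Scale.
Variable U : opens X.

(* [s *: m] is glued from the local sections [t *: m], where t lifts s. *)
Definition descent_scale (s : reg U) (m : descent_sect U) : descent_sect U :=
  sval (cid (descent_scale_exists s m)).

Lemma descent_scaleE s m (V : opens Y) (VU : preim f V `<=` U) (t : reg V) :
  comorph f V t = res VU s ->
  mres (sub_push_open fP VU) (descent_scale s m) =
  t *: mres (sub_push_open fP VU) (m : G (push_open fP U)).
Proof. exact: (svalP (cid (descent_scale_exists s m))). Qed.

Fact descent_scalerA a b m :
  descent_scale a (descent_scale b m) = descent_scale (a * b) m.
Proof.
apply: descent_local => y Uy.
have [V [VU [Vy [s [t [hs ht]]]]]] := comorph_local_lift2 a b Uy.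
exists V, VU; split=> //; rewrite (descent_scaleE _ hs) (descent_scaleE _ ht).
by rewrite scalerA (@descent_scaleE _ _ _ _ (s * t)) // !rmorphM /= hs ht.
Qed.

Fact descent_scale1r : left_id 1 descent_scale.
Proof.
move=> m; apply: descent_local => y Uy.
exists (push_open fP U), (@preim_push_openS _ _ _ _ fP U); split=> //.
by rewrite (@descent_scaleE _ _ _ _ 1) ?scale1r // !rmorph1.
Qed.

Fact descent_scalerDr : right_distributive descent_scale +%R.
Proof.
move=> a m n; apply: descent_local => y Uy.
have [V [VU [Vy [s hs]]]] := comorph_local_lift a Uy.
exists V, VU; split=> //.
by rewrite mresD !(descent_scaleE _ hs) mresD scalerDr.
Qed.

Fact descent_scalerDl m : {morph descent_scale^~ m : a b / a + b}.
Proof.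
move=> a b; apply: descent_local => y Uy.
have [V [VU [Vy [s [t [hs ht]]]]]] := comorph_local_lift2 a b Uy.
exists V, VU; split=> //.
rewrite mresD (descent_scaleE _ hs) (descent_scaleE _ ht) -scalerDl.
by rewrite (@descent_scaleE _ _ _ _ (s + t)) // !rmorphD /= hs ht.
Qed.

HB.instance Definition _ := GRing.Zmodule_isLmodule.Build (reg U)
  (descent_sect U) descent_scalerA descent_scale1r descent_scalerDr
  descent_scalerDl.

End Scale.

Definition descent_res (U V : opens X) (VU : V `<=` U) :
    descent_sect U -> descent_sect V :=
  mres (push_openS fP VU).

Fact descent_res_linear (U V : opens X) (VU : V `<=` U) a m n :
  descent_res VU (a *: m + n) = res VU a *: descent_res VU m + descent_res VU n.
Proof.
rewrite /descent_res mresD; congr (_ + _); apply: descent_local => y Vy.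
have [W [WV [Wy [t ht]]]] := comorph_local_lift (res VU a) Vy.
have WU := subset_trans WV VU; exists W, WV; split=> //.
rewrite (mres_comp _ _ (sub_push_open fP WU)) (@descent_scaleE _ _ _ _ _ t).
  by rewrite (descent_scaleE _ ht) (mres_comp _ _ (sub_push_open fP WU)).
by rewrite ht; exact: res_comp.
Qed.

Fact descent_res_id (U : opens X) (UU : U `<=` U) m : descent_res UU m = m.
Proof. exact: mres_id. Qed.

Fact descent_res_comp (U V W : opens X) (VU : V `<=` U) (WV : W `<=` V)
  (WU : W `<=` U) m : descent_res WV (descent_res VU m) = descent_res WU m.
Proof. exact: mres_comp. Qed.

(* The opens [push_open fP (V k)] do not cover the complement of the image of f
   when the family V is empty, so this complement is added to the cover. *)
Fact descent_sheaf : sheaf_axiom (fun U V (VU : V `<=` U) =>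
  (descent_res VU : descent_sect U -> descent_sect V)).
Proof.
move=> U I V VU UV.
have off_open : open (~` range f) by case: fP => _ /closed_openC.
pose W (k : option I) := if k is Some k then push_open fP (V k) else
  Opens (openI (oset_open (push_open fP U)) off_open).
have WU k : W k `<=` push_open fP U.
  by case: k => [k|] y; [exact: (push_openS fP (VU k))|case].
have cover : (push_open fP U : set Y) `<=` \bigcup_k W k.
  move=> y Uy; have [[x _ fx]|nfy] := pselect (range f y); last by exists None.
  have [k _ Vx] := UV x (Uy x fx); exists (Some k) => //= x'.
  by rewrite -fx; case: fP => f_inj _ _ _ /f_inj ->.
have off (A : opens Y) (m n : G A) : A `<=` W None -> m = n.
  by move=> A0; apply: killed_off_range => x /A0[_]; apply; exists x.
have [sep glue] := @mod_sheaf _ Y G _ _ W WU cover.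
split=> [m n mn|s s_compat].
  apply: sep => -[k|]; last exact: off.
  by rewrite (Prop_irrelevance (WU (Some k)) (push_openS fP (VU k))); exact: mn.
pose s' k : G (W k) := if k is Some k then s k else 0.
have [|m hm] := glue s'.
  move=> [k|] [l|] A Ak Al; try by apply: off.
  have Vk : preim f A `<=` V k by move=> x /Ak; exact.
  have Vl : preim f A `<=` V l by move=> x /Al; exact.
  (* Compatibility on X over [preim f A] is an equality over an open of Y that contains A, and is
     then restricted to A. *)
  have AA : A `<=` push_open fP (preim f A) by exact: sub_push_open.
  have := congr1 (mres AA) (s_compat k l (preim f A) Vk Vl).
  by rewrite /descent_res !(mres_comp _ _ Ak) !(mres_comp _ _ Al).
exists m => k; rewrite -[RHS](hm (Some k)) /descent_res.
by rewrite (Prop_irrelevance (WU (Some k)) (push_openS fP (VU k))).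
Qed.

Definition descent : omodule X :=
  OModule descent_res_linear descent_res_id descent_res_comp descent_sheaf.

Definition push_descent_fun (V : opens Y) (m : push f descent V) : G V :=
  mres (sub_push_open fP (@sub_refl _ _)) (m : G (push_open fP (preim f V))).

Fact push_descent_linear V : linear (@push_descent_fun V).
Proof.
move=> a m n; rewrite /push_descent_fun mresD; congr (_ + _).
by apply: descent_scaleE; rewrite res_id.
Qed.

Fact push_descent_res (U V : opens Y) (VU : V `<=` U) m :
  mres VU (@push_descent_fun U m) = push_descent_fun (mres VU m).
Proof.
have VU' := subset_trans VU (sub_push_open fP (@sub_refl _ (preim f U))).
rewrite /push_descent_fun (mres_comp _ _ VU').
by rewrite -[RHS]/(mres _ (mres _ _)) (mres_comp _ _ VU').
Qed.

Definition push_descent : ohom (push f descent) G :=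
  mk_ohom push_descent_linear push_descent_res.

(** V and [push_open fP (preim f V)] have the same preimage, so [killed_res_bij] applies. *)
Lemma push_descent_bij (V : opens Y) : bijective (push_descent V).
Proof. by apply: killed_res_bij; exact: preim_push_openS. Qed.

End Descent.

Arguments push_descent_bij {K X Y f} fP {G} G_killed.

(** * The map induced on extension classes *)

(** The middle term descends to a module D on X. Composed with the isomorphism between its
    pushforward and [mid F], the two maps of F come from X by fullness, and exactness is checked on
    preimages of opens of Y, which are all the opens of X. *)
Lemma push_ext_surj (K : closedFieldType) (X Y : kspace K) (f : kmor X Y)
  (fP : is_closed_immersion f) (M N : omodule X)
  (F : extension (push f M) (push f N)) :
  (forall (V : opens Y) (t : reg V) (m : mid F V),
     ideal_of f V t -> t *: m = 0) ->
  exists F', ext_equiv (push_ext fP F') F.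
Proof.
move=> killed; pose D := descent fP killed.
have [beta betaK] := inverse_ohom (push_descent_bij fP killed).
set alpha := push_descent fP killed in betaK.
have alphaK V := (betaK V).1; have {}betaK V := (betaK V).2.
have [i i_push] := push_full fP (comp_ohom beta (incl F)).
have [p p_push] := push_full fP (comp_ohom (proj F) alpha).
have iE (V : opens Y) n : i (preim f V) n = beta V (incl F V n) by exact: i_push.
have pE (V : opens Y) m : p (preim f V) m = proj F V (alpha V m) by exact: p_push.
have i_inj U : injective (i U).
  have [V ->] := preim_surj fP U => m n; rewrite !iE.
  by move/(can_inj (betaK V)); exact: incl_inj.
have ip_exact U m : p U m = 0 <-> exists n, i U n = m.
  have [V eU] := preim_surj fP U; move: m; rewrite eU => m.
  rewrite pE; split=> [/(ext_exact (alpha V m))[n nm]|[n <-]].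
    by exists n; rewrite iE nm alphaK.
  by rewrite iE betaK; exact: (@proj_incl _ _ _ _ F V n).
have p_surj (U : opens X) (m : M U) (x : X) : oset U x ->
    exists (V : opens X) (VU : V `<=` U), oset V x /\
    exists s : D V, p V s = mres VU m.
  have [V eU] := preim_surj fP U; move: m; rewrite eU => m Vx.
  (* Here [Vx] says that f x lies in V, so surjectivity of [proj F] is used at the point f x. *)
  have [W [WV [Wx [s hs]]]] := proj_surj F (m : push f M V) Vx.
  exists (preim f W), (preim_sub (f := f) WV); split=> //.
  by exists (beta W s); rewrite pE betaK.
exists (Extension i_inj ip_exact p_surj), alpha; split=> [V|V n|V m].
- exact: push_descent_bij.
- by rewrite -[RHS]betaK -iE.
- by rewrite -pE.
Qed.

Lemma push_class_bij (K : closedFieldType) (X Y : kspace K) (f : kmor X Y)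
  (fP : is_closed_immersion f) (M N : omodule X) :
  (forall (F : extension (push f M) (push f N)) (V : opens Y) (t : reg V)
     (m : mid F V), ideal_of f V t -> t *: m = 0) ->
  bijective (push_class fP : Ext1 M N -> Ext1 (push f M) (push f N)).
Proof.
move=> killed.
have Phi_inj : injective (push_class fP : Ext1 M N -> _).
  move=> c d; have [F ->] := Ext1_class c; have [G ->] := Ext1_class d.
  by rewrite !push_classE => /eq_ext_class/push_ext_equivP/eq_ext_class.
have /choice[g gK] e : exists c : Ext1 M N, push_class fP c = e.
  have [F ->] := Ext1_class e; have [F' F'F] := push_ext_surj fP (@killed F).
  by exists (ext_class F'); rewrite push_classE; apply/eq_ext_class.
by exists g => // c; apply: Phi_inj; rewrite gK.
Qed.

(** From right to left, the representatives on Y are first replaced by pushforwards of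
    representatives on X; the Baer sum then descends. *)
Lemma push_class_add (K : closedFieldType) (X Y : kspace K) (f : kmor X Y)
  (fP : is_closed_immersion f) (M N : omodule X) (c d e : Ext1 M N) :
  ext_add c d e <->
  ext_add (push_class fP c) (push_class fP d) (push_class fP e).
Proof.
split=> [[F [G [H [cF dG eH FGH]]]]|].
  exists (push_ext fP F), (push_ext fP G), (push_ext fP H); split.
  - by exists F; split=> //; exact: ext_equiv_refl.
  - by exists G; split=> //; exact: ext_equiv_refl.
  - by exists H; split=> //; exact: ext_equiv_refl.
  - exact: push_baer_sum.
move=> [F' [G' [H' [[F [cF FF]] [G [dG GG]] [H [eH HH]] FGH]]]].
exists F, G, H; split=> //; apply: (@push_baer_sumP _ _ _ _ fP).
exact: (baer_sum_equiv FF GG (ext_equiv_sym HH) FGH).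
Qed.

Lemma push_class_scale (K : closedFieldType) (X Y : kspace K) (f : kmor X Y)
  (fP : is_closed_immersion f) (M N : omodule X) (a : K) (c e : Ext1 M N) :
  ext_scale a c e <-> ext_scale a (push_class fP c) (push_class fP e).
Proof.
split=> [[F [H [cF eH FH]]]|].
  exists (push_ext fP F), (push_ext fP H); split.
  - by exists F; split=> //; exact: ext_equiv_refl.
  - by exists H; split=> //; exact: ext_equiv_refl.
  - exact: push_scaled.
move=> [F' [H' [[F [cF FF]] [H [eH HH]] FH]]].
exists F, H; split=> //; apply: (@push_scaledP _ _ _ _ fP).
exact: (scaled_equiv FF (ext_equiv_sym HH) FH).
Qed.

(** * Action of the square of the ideal, and the isomorphism *)

(** For a and b in the ideal, b s maps to 0 in M and so comes from N, where a kills it. Elements of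
    the square are locally sums of such products a b. *)
Lemma ideal_sq_kills_ext (K : closedFieldType) (X Y : kspace K) (f : kmor X Y)
  (M N : omodule Y) (F : extension M N) :
  (forall (V : opens Y) (t : reg V) (m : M V), ideal_of f V t -> t *: m = 0) ->
  (forall (V : opens Y) (t : reg V) (n : N V), ideal_of f V t -> t *: n = 0) ->
  forall (V : opens Y) (t : reg V) (s : mid F V),
    ideal_sq f V t -> t *: s = 0.
Proof.
move=> killM killN V t s It; apply: sect_local => y Vy.
have [W [WV [Wy [n [a [b [Ia Ib tE]]]]]]] := It y Vy.
exists W, WV; split=> //.
(* The 0 on the right is written as [0 *: s] so that [mres_scale] computes its restriction. *)
rewrite mres_scale tE -[in RHS](scale0r s) mres_scale rmorph0 scale0r.
rewrite scaler_suml big1 // => k _; rewrite -scalerA.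
have [|m <-] := (ext_exact (b k *: mres WV s)).1.
  by rewrite linearZ /= killM.
by rewrite -linearZ /= killN // linear0.
Qed.

Theorem mainTheorem14 (R : realType) (C C2 S : kspace R[i])
    (i : kmor C C2) (j : kmor C2 S)
    (C2_double : is_primitive_double_curve i)
    (C2_projective : is_projective C2)
    (S_surface : is_smooth_surface S)
    (j_closed : is_closed_immersion j)
    (C2_ideal : forall U : opens S, ideal_of j U = ideal_sq (compk j i) U)
    (E : omodule C) (E_bundle : is_vector_bundle E) :
  let E2 : omodule C2 := push i E in
  let Phi : Ext1 E2 E2 -> Ext1 (push j E2) (push j E2) :=
    push_class j_closed in
  [/\ bijective Phi,
      forall c d e, ext_add c d e <-> ext_add (Phi c) (Phi d) (Phi e)
    & forall (a : R[i]) c e, ext_scale a c e <-> ext_scale a (Phi c) (Phi e)].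
Proof.
move=> E2 Phi; split; first last.
- by move=> a c e; exact: push_class_scale.
- by move=> c d e; exact: push_class_add.
(* It remains to see that the ideal of C2 kills F; by [C2_ideal] it is the square of the ideal of C
   in S. *)
apply: push_class_bij => F V t s It; move: (It); rewrite C2_ideal.
have killE (W : opens S) (a : reg W) (m : push j E2 W) :
    ideal_of (compk j i) W a -> a *: m = 0.
  rewrite /ideal_of /= => a0.
  (* Unfolding both restrictions of scalars shows that a acts on E through the comorphism of the
     composite C -> S. *)
  rewrite -[LHS]/((comorph i _ (comorph j W a)) *: (m : E _)).
  by rewrite a0 scale0r.
exact: (@ideal_sq_kills_ext _ _ _ (compk j i)).
Qed.
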